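(* Let $N, n_x$ be positive integers and let $A_i\in\mathbb{R}^{n_x\times n_x}$, $b_i\in\mathbb{R}^{n_x}$, $i\in\{1,\dots,N\}$, be the data of a switched affine system. Let $x^*\in\mathbb{R}^{n_x}$ be such that $\dim(\mathrm{Null}(M(x^* )))=m>0$. Then the following statements are equivalent: (1) $x^*\in\mathcal{X}_F$; (2) there exists a (componentwise) non-negative $v\in\mathbb{R}^N$ such that $v\neq 0$ and $M(x^* )v=0$.
   Context: The switched affine system is $\dot x(t)=A_{\sigma(t)}x(t)+b_{\sigma(t)}$ with switching signal $\sigma(t)\in\{1,\dots,N\}$. The unit simplex is $\Lambda=\{\lambda\in\mathbb{R}^N : \mathbf{1}'\lambda=1,\ \lambda\ge 0\}$, where $\mathbf{1}$ is the vector of ones, $'$ denotes transpose and $\lambda\geq 0$ is componentwise. For $\lambda\in\Lambda$, $A(\lambda)=\sum_{i=1}^N\lambda_iA_i$ and $b(\lambda)=\sum_{i=1}^N\lambda_ib_i$. The set of equilibrium points (in the Filippov sense) is $\mathcal{X}_F=\{x\in\mathbb{R}^{n_x} : A(\lambda)x+b(\lambda)=0 \text{ for some }\lambda\in\Lambda\}$. For $x\in\mathbb{R}^{n_x}$, $M(x)\in\mathbb{R}^{n_x\times N}$ is the matrix whose $i$-th column is $A_ix+b_i$, so that $M(x)\lambda=A(\lambda)x+b(\lambda)$ for $\lambda\in\Lambda$. $\mathrm{Null}$ denotes the null space (kernel) of a matrix. *)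

(* Defs.v *)
From mathcomp Require Export all_boot all_order all_algebra.
From mathcomp Require Export classical_sets reals.

Set Implicit Arguments.
Unset Strict Implicit.
Unset Printing Implicit Defensive.

Import Order.TTheory GRing.Theory Num.Theory.

Local Open Scope classical_set_scope.
Local Open Scope ring_scope.

Section SwitchedAffineSystem.
Variables (R : realType) (N n : nat).

Definition nonneg_vec (v : 'cV[R]_N) : Prop := forall i, 0 <= v i 0.

Definition unit_simplex : set 'cV[R]_N :=
  [set l : 'cV[R]_N | \sum_i l i 0 = 1 /\ nonneg_vec l].

(* Subspace of column vectors; MathComp's [kermx] is the left (row) kernel. *)
Definition null_space (M : 'M[R]_(n, N)) : {vspace 'cV[R]_N} :=
  lker (linfun (mulmx M : 'cV[R]_N -> 'cV[R]_n)).

Variables (A : 'I_N -> 'M[R]_n) (b : 'I_N -> 'cV[R]_n).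

Definition comb_A (l : 'cV[R]_N) : 'M[R]_n := \sum_i l i 0 *: A i.
Definition comb_b (l : 'cV[R]_N) : 'cV[R]_n := \sum_i l i 0 *: b i.

Definition filippov_equilibria : set 'cV[R]_n :=
  [set x : 'cV[R]_n | exists2 l, unit_simplex l & comb_A l *m x + comb_b l = 0].

Definition field_matrix (x : 'cV[R]_n) : 'M[R]_(n, N) :=
  \matrix_(i < n, j < N) (A j *m x + b j) i 0.

End SwitchedAffineSystem.

(* Main.v *)
Require Import Defs.

Import Order.TTheory GRing.Theory Num.Theory.
Local Open Scope ring_scope.

(** By [field_matrix_mul], an equilibrium is a point whose matrix kills some vector of the simplex.
    Such a vector is nonzero, since its entries sum to 1. Conversely, the kernel is closed under
    scaling, and a nonzero nonnegative vector has positive sum ([nonneg_vec_sum_gt0]), so dividing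
    by that sum lands in the simplex. *)

Lemma field_matrix_mul {R : realType} {N n : nat}
    (A : 'I_N -> 'M[R]_n) (b : 'I_N -> 'cV[R]_n) (x : 'cV[R]_n) (l : 'cV[R]_N) :
  field_matrix A b x *m l = comb_A A l *m x + comb_b b l.
Proof.
rewrite /comb_A /comb_b mulmx_suml -big_split /=.
apply/matrixP => i j; rewrite ord1 mxE summxE; apply: eq_bigr => k _.
by rewrite -scalemxAl -scalerDr !mxE mulrC.
Qed.

(** Nonnegative terms with zero sum all vanish; this makes the normalisation by the sum
    legitimate. *)
Lemma nonneg_vec_sum_gt0 {R : realType} {N : nat} {v : 'cV[R]_N} :
  nonneg_vec v -> v <> 0 -> 0 < \sum_i v i 0.
Proof.
move=> v_ge0 v_neq0; rewrite lt_def sumr_ge0 // andbT.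
apply/eqP => sum0; apply: v_neq0; apply/matrixP => i j.
by rewrite ord1 mxE; apply: (psumr_eq0P _ sum0).
Qed.

Theorem proposition2 (R : realType) (N n : nat) (hN : (0 < N)%N) (hn : (0 < n)%N)
    (A : 'I_N -> 'M[R]_n) (b : 'I_N -> 'cV[R]_n)
    (xs : 'cV[R]_n) (m : nat)
    (hdim : \dim (null_space (field_matrix A b xs)) = m) (hm : (0 < m)%N) :
  filippov_equilibria A b xs <->
  (exists v : 'cV[R]_N,
     [/\ nonneg_vec v, v <> 0 & field_matrix A b xs *m v = 0]).
Proof.
split=> [[l [sum1 l_ge0] eq0] | [v [v_ge0 v_neq0 Mv0]]].
  exists l; split=> //; last by rewrite field_matrix_mul.
  (* A zero [l] would turn [sum1] into 0 = 1. *)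
  move=> l0; move/eqP: sum1; rewrite l0 big1 ?(eq_sym 0) ?oner_eq0 // => i _.
  by rewrite mxE.
have s_gt0 := nonneg_vec_sum_gt0 v_ge0 v_neq0.
set s := \sum_i v i 0 in s_gt0.
(* Rescaling makes the entries sum to 1 and stays in the kernel. *)
exists (s^-1 *: v); last by rewrite -field_matrix_mul -scalemxAr Mv0 scaler0.
split=> [|i]; last by rewrite mxE mulr_ge0 // invr_ge0 ltW.
under eq_bigr do rewrite mxE.
by rewrite -mulr_sumr mulVf // gt_eqF.
Qed.
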